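(* Let $G$ be a finite abelian group of order $n$, and let $S$ be a sequence over $G$ with $|S|=n$. Then \[ MZ(S)\le n-|\operatorname{supp}(S)|+1. \] Equivalently, if $MZ(S)=n-s$ for some $s\in\{0,\ldots,n-1\}$, then $|\operatorname{supp}(S)|\le s+1$.
   Context: Groups are written additively. A sequence $S$ over a finite abelian group $G$ is a finite multiset of elements of $G$ (order irrelevant, repetition allowed); a subsequence is a submultiset of occurrences. $|S|$ denotes the length of $S$ (number of terms counted with multiplicity), and $\operatorname{supp}(S)$ denotes the set of distinct elements of $G$ occurring in $S$. A subsequence is zero-sum if the sum of its terms (with multiplicity) is $0$. $MZ(S)$ is the smallest positive integer $r$ such that $S$ has a zero-sum subsequence of length $r$; if $S$ has no nonempty zero-sum subsequence, $MZ(S)=\infty$. *)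

(* Defs.v *)
From HB Require Import structures.
From mathcomp Require Import all_boot all_order all_algebra.
From mathcomp Require Import finmap multiset.
From mathcomp Require Import boolp constructive_ereal.

Set Implicit Arguments.
Unset Strict Implicit.
Unset Printing Implicit Defensive.

Import Order.TTheory GRing.Theory Num.Theory.

Local Open Scope mset_scope.
Local Open Scope ring_scope.

Definition zero_sum (G : zmodType) (T : {mset G}) : Prop := \sum_(x <- T) x = 0.

Definition has_zero_sum_subseq (G : zmodType) (S : {mset G}) (r : nat) : bool :=
  `[< exists T : {mset G}, [/\ T `<=` S, size T = r & zero_sum T] >].

(* [\bar int] supplies the value +oo together with the library's order on it. *)
Definition MZ (G : zmodType) (S : {mset G}) : \bar int :=
  match pselect (exists r : nat, (0 < r)%N && has_zero_sum_subseq S r) with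
  | left exS => (ex_minn exS)%:Z%:E%E
  | right _ => +oo%E
  end.

Definition supp (G : zmodType) (S : {mset G}) : {fset G} := finsupp S.

(* Main.v *)
(* Fix one copy of each element of supp S; the remaining n - |supp S| terms are
   added one at a time.  Let B be the set of sums using at most one of the fixed
   copies together with the terms added so far.  If 0 is not in S, then initially
   |B| >= |supp S| + 1.  Adding a term x replaces B by (at least) B u (B + x), which
   is strictly larger unless B + x = B; in that case -x is in B, since 0 is, and we
   obtain a zero-sum using at most one fixed copy.  As |B| <= n, growth must
   fail at some step. *)

Require Import Defs.
From HB Require Import structures.
From mathcomp Require Import all_boot all_order all_algebra.
From mathcomp Require Import finmap multiset.
From mathcomp Require Import boolp constructive_ereal.
From mathcomp Require Import zify.

Set Implicit Arguments.
Unset Strict Implicit.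
Unset Printing Implicit Defensive.

Import Order.TTheory GRing.Theory Num.Theory.

Local Open Scope fset_scope.
Local Open Scope mset_scope.
Local Open Scope ring_scope.

(* Only the length of T is bounded, which is weaker than using at most one element
   of A but equally sufficient. *)
Definition short_sub (G : finZmodType) (A : {set G}) (s T : seq G) : Prop :=
  (size T <= (size s).+1)%N
  /\ forall x, (count_mem x T <= (x \in A) + count_mem x s)%N.

Definition short_sums (G : finZmodType) (A : {set G}) (s : seq G) : {set G} :=
  [set b | `[< exists2 T, short_sub A s T & \sum_(x <- T) x = b >]].

Lemma short_sub_nil (G : finZmodType) (A : {set G}) (s : seq G) :
  short_sub A s [::].
Proof. by split. Qed.

Lemma short_sub_consr (G : finZmodType) (A : {set G}) (x : G) (s T : seq G) :
  short_sub A s T -> short_sub A (x :: s) T.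
Proof.
move=> [szT cntT]; split=> [|y /=]; first exact: leqW.
by apply: leq_trans (cntT y) _; rewrite leq_add2l leq_addl.
Qed.

Lemma short_sub_cons (G : finZmodType) (A : {set G}) (x : G) (s T : seq G) :
  short_sub A s T -> short_sub A (x :: s) (x :: T).
Proof.
move=> [szT cntT]; split=> //= y.
by rewrite addnCA leq_add2l.
Qed.

(** Translation by [x] is injective, so on the finite set [B] it is a permutation; the preimage of
    [0] is [- x]. *)
Lemma add_closed_opp (G : finZmodType) (B : {set G}) (x : G) :
  0 \in B -> (forall b, b \in B -> b + x \in B) -> - x \in B.
Proof.
move=> B0 Bx.
have imB : [set b + x | b in B] = B.
  apply/eqP; rewrite eqEcard card_imset ?leqnn ?andbT; last exact: addIr.
  by apply/subsetP => _ /imsetP[b bB ->]; exact: Bx.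
move: B0; rewrite -{1}imB => /imsetP[b bB /esym/eqP].
by rewrite addr_eq0 => /eqP <-.
Qed.

Lemma zero_short_sub_or_card (G : finZmodType) (A : {set G}) (s : seq G) :
  (exists T, [/\ short_sub A s T, (0 < size T)%N & \sum_(x <- T) x = 0])
  \/ (#|A| + size s < #|short_sums A s|)%N.
Proof.
elim: s => [|x s [[T [subT T_gt0 T0]]|ltB]].
(* If [0] is not in [A], the empty sum and the singletons give [#|A| + 1] distinct sums, which is
   why the inequality is strict. *)
- case: (boolP (0 \in A)) => [A0 | An0].
    left; exists [:: 0]; split; rewrite ?big_seq1 //; split=> //= y.
    by rewrite !addn0; case: eqP => // <-; rewrite A0.
  right; rewrite addn0 -[X in (X <= _)%N]add1n.
  have <- : #|0 |: A| = (1 + #|A|)%N by rewrite cardsU1 An0.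
  apply/subset_leq_card/subsetP => a; rewrite !inE => /orP[/eqP ->|aA].
    by apply/asboolP; exists [::]; rewrite ?big_nil //; exact: short_sub_nil.
  apply/asboolP; exists [:: a]; rewrite ?big_seq1 //; split=> //= y.
  by rewrite !addn0; case: eqP => // <-; rewrite aA.
- by left; exists T; split=> //; exact: short_sub_consr.
- set B := short_sums A s in ltB *.
  have B0 : 0 \in B.
    by rewrite inE; apply/asboolP; exists [::];
       [exact: short_sub_nil | rewrite big_nil].
  (* Appending [x] to a [T] of sum [- x] gives a zero-sum that is nonempty even when [T] is
     empty. *)
  case: (boolP (- x \in B)) => [|Bnx].
    rewrite inE => /asboolP[T subT Tx].
    left; exists (x :: T); split=> //; first exact: short_sub_cons.
    by rewrite big_cons Tx subrr.
  right; rewrite addnS; apply: (leq_ltn_trans ltB).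
  apply: proper_card; apply/properP; split.
    apply/subsetP => b; rewrite !inE => /asboolP[T subT Tb].
    by apply/asboolP; exists T => //; exact: short_sub_consr.
  have [b bB bxB] : exists2 b, b \in B & b + x \notin B.
    apply/exists_inP; rewrite -negb_forall_in.
    by apply: contra Bnx => /forall_inP; exact: add_closed_opp.
  exists (b + x) => //.
  move: bB; rewrite !inE => /asboolP[T subT Tb].
  apply/asboolP; exists (x :: T); first exact: short_sub_cons.
  by rewrite big_cons Tb addrC.
Qed.

Lemma exists_zero_short_sub (G : finZmodType) (A : {set G}) (s : seq G) :
  (#|G| <= #|A| + size s)%N ->
  exists T, [/\ short_sub A s T, (0 < size T)%N & \sum_(x <- T) x = 0].
Proof.
move=> leG; case: (zero_short_sub_or_card A s) => // ltB.
by have := leq_trans ltB (leq_trans (max_card _) leG); rewrite ltnn.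
Qed.

Lemma MZ_le (G : zmodType) (S : {mset G}) (r : nat) :
  (0 < r)%N -> has_zero_sum_subseq S r -> (MZ S <= r%:Z%:E)%E.
Proof.
move=> r_gt0 Sr; have Pr : (0 < r)%N && has_zero_sum_subseq S r by rewrite r_gt0.
rewrite /MZ; case: pselect => [exS|nS]; last by case: nS; exists r.
by case: ex_minnP => m _ /(_ _ Pr); rewrite lee_fin lez_nat.
Qed.

(** The bound is written additively to avoid truncated subtraction in [nat]. *)
Lemma short_zero_sum_subseq (G : finZmodType) (S : {mset G}) :
  (#|G| <= size S)%N ->
  exists r : nat, [/\ (0 < r)%N, (r + #|` supp S| <= size S + 1)%N &
                      has_zero_sum_subseq S r].
Proof.
move=> leG.
(* [t] holds one copy of each element of the support and [s] the remaining terms, so [(size s).+1]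
   is exactly the length allowed. *)
pose t := undup S; pose s : seq G := enum_mset (S `\` seq_mset t).
have cntS x : S x = ((x \in S) + count_mem x s)%N.
  rewrite /s count_mem_mset msetE2 mset_seqE /t count_uniq_mem ?undup_uniq //.
  by rewrite mem_undup subnKC // in_mset; case: (S x).
have sizeS : size S = (size t + size s)%N.
  rewrite -size_cat; apply/perm_size/allP => x _ /=.
  rewrite count_cat count_mem_mset cntS (count_uniq_mem x (undup_uniq S)).
  by rewrite mem_undup.
have card_supp : #|` supp S| = size t.
  by symmetry; apply/perm_size/perm_undup_mset.
have cardA : #|[set x in t]| = size t.
  by rewrite cardsE; apply/card_uniqP/undup_uniq.
have [|T [[szT cntT] T_gt0 T0]] := @exists_zero_short_sub G [set x in t] s.
  by rewrite cardA -sizeS.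
exists (size T); split=> //.
  by rewrite card_supp sizeS; lia.
apply/asboolP; exists (seq_mset T); split.
(* By [cntS], the multiplicity bound in [short_sub] is the multiplicity of [x] in [S]. *)
- apply/msubsetP => x; rewrite mset_seqE cntS.
  by have := cntT x; rewrite inE /t mem_undup.
- exact/perm_size/perm_eq_seq_mset.
- by rewrite /zero_sum (perm_big _ (perm_eq_seq_mset T)).
Qed.

Theorem theorem3p1 (G : finZmodType) (n : nat) (hG : #|G| = n)
    (S : {mset G}) (hS : size S = n) :
  (MZ S <= (n%:Z - #|` supp S|%:Z + 1)%:E)%E
  /\ (forall s : nat, (s < n)%N ->
        MZ S = (n%:Z - s%:Z)%:E%E -> (#|` supp S| <= s + 1)%N).
Proof.
have [r [r_gt0 le_r Sr]] := short_zero_sum_subseq (eq_leq (etrans hG (esym hS))).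
have leMZ : (MZ S <= (n%:Z - #|` supp S|%:Z + 1)%:E)%E.
  apply: le_trans (MZ_le r_gt0 Sr) _.
  by rewrite lee_fin; move: le_r; rewrite hS; lia.
split=> // s lt_sn MZs; move: leMZ; rewrite MZs lee_fin; lia.
Qed.
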